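(* For $n\ge 2$ let $P_n$ be the law of the descent set of a uniformly random permutation in the symmetric group $S_n$, a point process on $\{1,\dots,n-1\}$; explicitly, for $S=\{s_1<\dots<s_k\}\subseteq\{1,\dots,n-1\}$, $$P_n(S)=\det\left[\frac{1}{(s_{j+1}-s_i)!}\right]_{i,j=0}^k,\qquad s_0=0,\ s_{k+1}=n.$$ There exists a stationary point process $P$ on $\mathbb{Z}$ such that, for every $n\ge2$, its restriction to any interval of length $n-1$ (i.e. consisting of $n-1$ consecutive integers) coincides, up to translation, with $P_n$. The process $P$ is one-dependent and determinantal. Its correlation kernel is $K(x,y)=k(y-x)$ with (Laurent expansion at $z=0$) $$\sum_{m\in\mathbb{Z}}k(m)z^m=\frac{1}{1-e^{z}}.$$
   Context: A permutation $\sigma\in S_n$ has a descent at $i$ ($1\le i\le n-1$) if $\sigma(i)>\sigma(i+1)$; the descent set is the set of such $i$. In the determinant, $1/m!=0$ for $m<0$. A point process on a discrete set $\mathcal{X}$ is a probability measure on subsets $S$ of $\mathcal{X}$, with correlation function $\rho(A)=P\{S:S\supseteq A\}$ for finite $A$. A process on $\mathbb{Z}$ is stationary if its law is invariant under translations; one-dependent if $\rho(X\cup Y)=\rho(X)\rho(Y)$ for finite $X,Y$ with $|x-y|\ge2$ for all $x\in X,y\in Y$; determinantal with correlation kernel $K$ if $\rho(A)=\det(K(x,y))_{x,y\in A}$ for all finite $A$. *)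

(* Defs.v *)
From HB Require Import structures.
From mathcomp Require Import all_boot all_order all_algebra all_fingroup.
From mathcomp Require Import finmap.
From mathcomp Require Import all_classical all_reals all_analysis.
From mathcomp Require Import complex.
Set Implicit Arguments.
Unset Strict Implicit.
Unset Printing Implicit Defensive.
Import Order.TTheory GRing.Theory Num.Theory.
Import numFieldNormedType.Exports.
Local Open Scope classical_set_scope.
Local Open Scope ring_scope.

(** Subsets of a discrete set [X] carry the product sigma-algebra of [{0,1}^X],
    generated by the events "[x] belongs to [S]". *)
Definition occupied (X : Type) (x : X) : set (set X) := [set S | S x].

Definition configuration (X : Type) :=
  g_sigma_algebraType (range (@occupied X)).

Definition point_process (X : Type) (R : realType) :=
  probability (configuration X) R.

Definition correlation (X : choiceType) (R : realType)
    (P : point_process X R) (A : {fset X}) : \bar R :=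
  P [set S : set X | forall x, x \in A -> S x].

Definition translate (t : int) (S : configuration int) : configuration int :=
  [set x + t | x in S].

Definition stationary (R : realType) (P : point_process int R) :=
  forall (t : int) (E : set (configuration int)), measurable E ->
    pushforward P (translate t) E = P E.

Definition one_dependent (R : realType) (P : point_process int R) :=
  forall X Y : {fset int},
    (forall x y, x \in X -> y \in Y -> 2 <= `|x - y|) ->
    correlation P (X `|` Y)%fset = (correlation P X * correlation P Y)%E.

(** The determinant does not depend on the order in which [A] is enumerated. *)
Definition minor (X : choiceType) (R : realType) (K : X -> X -> R)
    (A : {fset X}) : R :=
  \det (\matrix_(i < #|` A|, j < #|` A|)
    K (tnth (in_tuple A) i) (tnth (in_tuple A) j)).

Definition determinantal (X : choiceType) (R : realType)
    (P : point_process X R) (K : X -> X -> R) :=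
  forall A : {fset X}, correlation P A = (minor K A)%:E.

(** Permutations act on [{0, ..., n-1}], whereas descents are numbered
    [1, ..., n-1] as usual: [i.-1] and [i] are the 0-based positions of the
    [i]-th and [i+1]-st letters. *)
Definition has_descent (n : nat) (s : 'S_n) (i : nat) : bool :=
  [exists a : 'I_n, exists b : 'I_n,
    [&& a.+1 == i, nat_of_ord b == i & (s b < s a)%N]].

Definition descent_set (n : nat) (s : 'S_n) : {fset nat} :=
  [fset i in iota 1 n.-1 | has_descent s i]%fset.

(** Probability mass function of [P_n]. *)
Definition descent_law (R : realType) (n : nat) (S : {fset nat}) : R :=
  #|[set s : 'S_n | descent_set s == S]%SET|%:R / n`!%:R.

Definition inv_fact (R : realType) (m : int) : R :=
  if m is Posz k then k`!%:R^-1 else 0.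

(** [s_0 = 0 < s_1 < ... < s_k < s_{k+1} = n] *)
Definition breakpoints (n : nat) (S : {fset nat}) : seq nat :=
  0%N :: rcons (sort leq S) n.

Definition descent_det (R : realType) (n : nat) (S : {fset nat}) : R :=
  let s := nth 0%N (breakpoints n S) in
  \det (\matrix_(i < #|` S|.+1, j < #|` S|.+1)
    inv_fact R ((s j.+1)%:Z - (s i)%:Z)).

(** The event that [S] meets [{a+1, ..., a+n-1}] exactly in [a + A]. *)
Definition window_event (n : nat) (a : int) (A : {fset nat}) :
    set (configuration int) :=
  [set S : set int | forall i : nat, (0 < i < n)%N -> S (a + i%:Z) <-> i \in A].

(** Seen as a [numClosedFieldType], [R[i]] inherits the topology of its norm. *)
Definition Cplx (R : realType) : numClosedFieldType := R[i].

Definition cexp (R : realType) (z : Cplx R) : Cplx R :=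
  limn (series (fun n => z ^+ n / n`!%:R)).

(** [f z] is the sum of [k m * z ^ m] over all integers [m], for all [z <> 0]
    close to [0]; [Negz n] is the integer [-(n+1)], so that the second series
    is the one over negative indices. *)
Definition laurent_expansion_at0 (R : realType) (f : Cplx R -> Cplx R)
    (k : int -> R) :=
  let term (z : Cplx R) (m : int) : Cplx R := real_complex R (k m) * z ^ m in
  \forall z \near (0 : Cplx R)^',
    exists u v : Cplx R,
      [/\ series (fun n => term z (Posz n)) @ \oo --> u,
          series (fun n => term z (Negz n)) @ \oo --> v
        & f z = u + v].

(* Main.v *)
(* Fix a window of [n] letters. Averaging over [S_m x S_l] shows that the
   descents on the two sides of an unconstrained position of a uniform
   permutation are independent, so the probability that the descent set contains
   [A] is the product of [1 / (l+1)!] over the maximal runs of [A], [l] being the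
   length of the run. This does not depend on the window: it is a translation
   invariant candidate for the correlation function, whose inclusion-exclusion
   sums are probabilities, hence nonnegative; such a function is the correlation
   function of a process, which can be built from one uniform variable on [0, 1[.

   Both determinants are of Hessenberg type. Expanding along the first column,
   with a free first row, gives for [1 / (s_{j+1} - s_i)!] the inclusion-exclusion
   on the descent at [s_1]. As [k(-1) = -1] and [k(m) = 0] for [m < -1], it makes
   [det k(y - x)] multiplicative over runs, and reduces its value on a run to
   the recursion expressing [(1 - e^z) * k(z) = 1]. *)

Require Import Defs.
From HB Require Import structures.
From mathcomp Require Import all_boot all_order all_algebra all_fingroup.
From mathcomp Require Import finmap.
From mathcomp Require Import all_classical all_reals all_analysis.
From mathcomp Require Import complex.
From mathcomp Require Import zify ring lra.
Set Implicit Arguments.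
Unset Strict Implicit.
Unset Printing Implicit Defensive.
Import Order.TTheory GRing.Theory Num.Theory.
Import numFieldNormedType.Exports.
Local Open Scope classical_set_scope.
Local Open Scope ring_scope.

(** * Descents and the relative order of letters *)

Lemma has_descentE n (s : 'S_n) (a b : 'I_n) :
  b = a.+1 :> nat -> has_descent s b = (s b < s a)%N.
Proof.
move=> ba; apply/existsP/idP => [[a' /existsP[b' /and3P[/eqP a'b /eqP b'b]]]|ltba].
  have -> : b' = b by apply: val_inj.
  by have -> : a' = a by apply: val_inj => /=; lia.
by exists a; apply/existsP; exists b; rewrite ba !eqxx.
Qed.

(** A descent at [k + i] with [0 < i < m] compares two letters of the window starting at [k], so
    only their relative order matters. *)
Lemma has_descent_transfer m n (s : 'S_n) (t : 'S_m) (f : 'I_m -> 'I_n) k :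
    (forall i, f i = (k + i)%N :> nat) ->
    (forall i j, (s (f i) < s (f j))%N = (t i < t j)%N) ->
  forall i, (0 < i < m)%N -> has_descent s (k + i) = has_descent t i.
Proof.
move=> fE st i /andP[i0 im]; have im1 : (i.-1 < m)%N by lia.
have -> : (k + i)%N = f (Ordinal im) by rewrite fE.
rewrite (@has_descentE _ _ (f (Ordinal im1))); last by rewrite !fE /=; lia.
by rewrite st -(@has_descentE _ _ (Ordinal im1) (Ordinal im)) //=; lia.
Qed.

(** Each value is replaced by its rank, the number of smaller values. *)
Lemma standardization m (u : 'I_m -> nat) : injective u ->
  exists p : 'S_m, forall i j, (p i < p j)%N = (u i < u j)%N.
Proof.
move=> uI; pose rk i := #|[set j | (u j < u i)%N]%SET|.
have rk_lt i j : (u i < u j)%N -> (rk i < rk j)%N.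
  move=> uij; apply: proper_card; apply/properP; split.
    by apply/fintype.subsetP => h; rewrite !inE => /ltn_trans; apply.
  by exists i; rewrite !inE // ltnn.
have rkE i j : (rk i < rk j)%N = (u i < u j)%N.
  apply/idP/idP => [|/rk_lt //]; apply: contraLR; rewrite -2!leqNgt leq_eqVlt.
  by move=> /orP[/eqP/uI-> //|/rk_lt/ltnW].
have rk_m i : (rk i < m)%N.
  rewrite -[X in (_ < X)%N]card_ord; apply: proper_card; apply/properP; split.
    exact/fintype.subsetP.
  by exists i; rewrite // !inE ltnn.
have rkI : injective (fun i => Ordinal (rk_m i)).
  move=> i j /(congr1 val)/= e; apply: uI; apply/eqP.
  by have [|uij|//] := ltngtP (u i) (u j); [|move: uij]; rewrite -rkE e ltnn.
by exists (perm rkI) => i j; rewrite !permE /= rkE.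
Qed.

(** A letter equals the number of letters smaller than it, which the relative order determines. *)
Lemma perm_order_inj m (s t : 'S_m) :
  (forall i j, (s i < s j)%N = (t i < t j)%N) -> s = t.
Proof.
have rankE (p : 'S_m) i : p i = #|[set j | (p j < p i)%N]%SET| :> nat.
  rewrite -(card_preimset _ (@perm_inj _ p^-1%g)) -[LHS]card_ord.
  pose w := widen_ord (ltnW (ltn_ord (p i))).
  rewrite -(card_codom (f := w)); last by move=> x y /(congr1 val)/= /val_inj.
  apply: eq_card => j; rewrite !inE permKV; apply/codomP/idP => [[x ->]|ji].
    exact: (ltn_ord x).
  by exists (Ordinal ji); apply: val_inj.
move=> st; apply/permP => i; apply: val_inj => /=; rewrite (rankE s) (rankE t).
by apply: eq_card => j; rewrite !inE st.
Qed.

(** * The subgroup [S_m x S_l] of [S_(m + l)] *)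

Section BlockSum.
Variables (m l : nat) (s : 'S_m) (t : 'S_l).

Definition block_fun (i : 'I_(m + l)) : 'I_(m + l) :=
  match fintype.split i with inl j => lshift l (s j) | inr k => rshift m (t k) end.

Lemma block_fun_inj : injective block_fun.
Proof.
move=> i j; rewrite /block_fun.
case: (split_ordP i) => i' ->; case: (split_ordP j) => j' ->.
- by move/lshift_inj/perm_inj->.
- by move/eqP; rewrite eq_lrshift.
- by move/eqP; rewrite eq_rlshift.
- by move/rshift_inj/perm_inj->.
Qed.

Definition block_perm : 'S_(m + l) := perm block_fun_inj.

Lemma block_perm_lshift i : block_perm (lshift l i) = lshift l (s i).
Proof.
rewrite permE /block_fun.
by case: split_ordP => j /eqP; rewrite ?eq_lrshift // => /eqP/lshift_inj->.
Qed.

Lemma block_perm_rshift i : block_perm (rshift m i) = rshift m (t i).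
Proof.
rewrite permE /block_fun.
by case: split_ordP => j /eqP; rewrite ?eq_rlshift // => /eqP/rshift_inj->.
Qed.

End BlockSum.

(** * Probabilities of descent patterns *)

(** Positions in neither list are free: this allows inclusion-exclusion on one position and cutting
    the permutation at another. *)
Definition desc_pattern (A C : seq nat) n (s : 'S_n) :=
  all (has_descent s) A && all (fun i => ~~ has_descent s i) C.

Definition desc_prob (R : realType) n (A C : seq nat) : R :=
  #|[set s : 'S_n | desc_pattern A C s]%SET|%:R / n`!%:R.

(* Averaging over right translates by [S_m x S_l]: whatever the permutation,
   its restrictions to the first [m] and last [l] positions are then
   independent and uniform up to standardization. *)
Lemma card_desc_pattern_cat m l (A1 C1 A2 C2 : seq nat) :
    {in A1 ++ C1, forall i, 0 < i < m}%N -> {in A2 ++ C2, forall i, 0 < i < l}%N ->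
  (m`! * l`! * #|[set s : 'S_(m + l) |
      desc_pattern (A1 ++ map (addn m) A2) (C1 ++ map (addn m) C2) s]%SET| =
   (m + l)`! * (#|[set s : 'S_m | desc_pattern A1 C1 s]%SET| *
                #|[set s : 'S_l | desc_pattern A2 C2 s]%SET|))%N.
Proof.
move=> in1 in2; set Q := fun s : 'S_(m + l) => _.
have cardE n (P : pred 'S_n) : #|[set s | P s]%SET| = (\sum_s (P s : nat))%N.
  by rewrite -sum1dep_card big_mkcond.
have fixed (u : 'S_(m + l)) :
    (\sum_(s : 'S_m) \sum_(t : 'S_l) (Q (block_perm s t * u)%g : nat) =
     #|[set s : 'S_m | desc_pattern A1 C1 s]%SET| *
     #|[set s : 'S_l | desc_pattern A2 C2 s]%SET|)%N.
  have [p pE] := @standardization m (fun i => u (lshift l i))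
    (fun i j e => lshift_inj (perm_inj (val_inj e))).
  have [q qE] := @standardization l (fun i => u (rshift m i))
    (fun i j e => rshift_inj (perm_inj (val_inj e))).
  have QE s t : Q (block_perm s t * u)%g =
      desc_pattern A1 C1 (s * p)%g && desc_pattern A2 C2 (t * q)%g.
    have d1 : {in A1 ++ C1, has_descent (block_perm s t * u)%g =1
                            has_descent (s * p)%g}.
      move=> i /in1 im.
      apply: (@has_descent_transfer _ _ _ _ (@lshift m l) 0) => // a b.
      by rewrite !permM !block_perm_lshift pE.
    have d2 : {in A2 ++ C2, forall i, has_descent (block_perm s t * u)%g (m + i) =
                            has_descent (t * q)%g i}.
      move=> i /in2 im; apply: (@has_descent_transfer _ _ _ _ (@rshift m l) m) => //.
      by move=> a b; rewrite !permM !block_perm_rshift qE.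
    rewrite /Q /desc_pattern !all_cat !all_map andbACA.
    congr (_ && _ && (_ && _)); apply: eq_in_all => i iA /=.
    - by rewrite d1 // mem_cat iA.
    - by rewrite d1 // mem_cat iA orbT.
    - by rewrite d2 // mem_cat iA.
    - by rewrite d2 // mem_cat iA orbT.
  under eq_bigr do under eq_bigr do rewrite QE.
  (* Multiplication by [p] and by [q] permutes the two groups, so the standardizations drop out of
     the count. *)
  rewrite !cardE big_distrl /= [RHS](reindex_inj (mulIg p)) /=.
  apply: eq_bigr => s _; rewrite big_distrr /= [RHS](reindex_inj (mulIg q)) /=.
  by apply: eq_bigr => t _; rewrite mulnb.
(* The triple sum is evaluated twice: with [u] fixed by [fixed], and with [s] and [t] fixed by
   translating [u]. *)
transitivity (\sum_(u : 'S_(m + l)) \sum_(s : 'S_m) \sum_(t : 'S_l)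
    (Q (block_perm s t * u)%g : nat))%N; last first.
  rewrite (eq_bigr _ (fun u _ => fixed u)).
  by rewrite sum_nat_const card_Sn.
rewrite exchange_big /= (eq_bigr (fun=> l`! * #|[set u | Q u]%SET|)%N).
  by rewrite sum_nat_const card_Sn mulnA.
move=> s _; rewrite exchange_big /= -card_Sn -sum_nat_const cardE.
by apply: eq_bigr => t _; rewrite [RHS](reindex_inj (mulgI (block_perm s t))).
Qed.

Lemma all_descents_anti m (s : 'S_m) : all (has_descent s) (iota 1 m.-1) ->
  forall i j, (s i < s j)%N = (j < i)%N.
Proof.
move=> /allP ds.
have lt_s k (i j : 'I_m) : j = (i + k.+1)%N :> nat -> (s j < s i)%N.
  elim: k j => [|k IHk] j ji.
    rewrite -has_descentE ?ji ?addn1 //; apply: ds; rewrite mem_iota.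
    by have := ltn_ord j; lia.
  have im : (i + k.+1 < m)%N by have := ltn_ord j; lia.
  apply: ltn_trans (IHk (Ordinal im) erefl).
  rewrite -(@has_descentE _ _ (Ordinal im)) /=; last by lia.
  by apply: ds; rewrite mem_iota; have := ltn_ord j; lia.
have gt_s (i j : 'I_m) : (j < i)%N -> (s i < s j)%N.
  by move=> ji; apply: (lt_s (i - j).-1); lia.
move=> i j; apply/idP/idP => [|/gt_s //].
have [// | /gt_s ji ij|/val_inj -> ] := ltngtP (j : nat) i; last by rewrite ltnn.
by have := ltn_trans ji ij; rewrite ltnn.
Qed.

Lemma no_descents_mono m (s : 'S_m) :
  all (fun i => ~~ has_descent s i) (iota 1 m.-1) ->
  forall i j, (s i < s j)%N = (i < j)%N.
Proof.
move=> /allP ds i j.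
(* Reversing the values exchanges ascents and descents, which reduces the claim to
   [all_descents_anti]. *)
pose r := perm (@rev_ord_inj m).
have /all_descents_anti anti : all (has_descent (s * r)%g) (iota 1 m.-1).
  apply/allP => k kI; have := ds _ kI; move: kI; rewrite mem_iota => km.
  have k1 : (k < m)%N by lia.
  have k2 : (k.-1 < m)%N by lia.
  have kk : Ordinal k1 = (Ordinal k2).+1 :> nat by rewrite /=; lia.
  rewrite -[k]/(val (Ordinal k1)) !(has_descentE _ kk) -leqNgt leq_eqVlt.
  rewrite !permM !permE /= => /orP[/eqP/val_inj/perm_inj/(congr1 val)/=|].
    by lia.
  by have := ltn_ord (s (Ordinal k1)); lia.
have := anti j i; rewrite !permM !permE /= => <-.
by have := ltn_ord (s i); have := ltn_ord (s j); lia.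
Qed.

Lemma desc_prob_all (R : realType) m :
  desc_prob R m (iota 1 m.-1) [::] = (m`!%:R)^-1.
Proof.
rewrite /desc_prob /desc_pattern; suff -> : [set s : 'S_m |
    all (has_descent s) (iota 1 m.-1) && all (fun i => ~~ has_descent s i) [::]]%SET
  = [set perm (@rev_ord_inj m)]%SET by rewrite cards1 mul1r.
apply/setP => s; rewrite !inE andbT; apply/idP/eqP => [/all_descents_anti sa|->].
  apply: perm_order_inj => i j; rewrite sa !permE /=.
  by have := ltn_ord i; have := ltn_ord j; lia.
apply/allP => k; rewrite mem_iota => km.
have k1 : (k < m)%N by lia.
have k2 : (k.-1 < m)%N by lia.
rewrite -[k]/(val (Ordinal k1)) (@has_descentE _ _ (Ordinal k2)) ?permE /=; lia.
Qed.

Lemma desc_prob_none (R : realType) m :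
  desc_prob R m [::] (iota 1 m.-1) = (m`!%:R)^-1.
Proof.
rewrite /desc_prob /desc_pattern; suff -> : [set s : 'S_m |
    all (has_descent s) [::] && all (fun i => ~~ has_descent s i) (iota 1 m.-1)]%SET
  = [set 1%g]%SET by rewrite cards1 mul1r.
apply/setP => s; rewrite !inE /=; apply/idP/eqP => [/no_descents_mono sm|->].
  by apply: perm_order_inj => i j; rewrite sm !perm1.
apply/allP => k; rewrite mem_iota => km.
have k1 : (k < m)%N by lia.
have k2 : (k.-1 < m)%N by lia.
rewrite -[k]/(val (Ordinal k1)) (@has_descentE _ _ (Ordinal k2)) ?perm1 /=; lia.
Qed.

Lemma desc_prob_eq (R : realType) n (A C A' C' : seq nat) :
  A =i A' -> C =i C' -> desc_prob R n A C = desc_prob R n A' C'.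
Proof.
move=> eA eC; congr (_%:R / _); apply: eq_card => s.
by rewrite !inE /desc_pattern (eq_all_r eA) (eq_all_r eC).
Qed.

Lemma desc_prob_cons (R : realType) n (A C : seq nat) x :
  desc_prob R n A (x :: C) = desc_prob R n A C - desc_prob R n (x :: A) C.
Proof.
apply/eqP; rewrite eq_sym subr_eq -mulrDl -natrD; apply/eqP; congr (_%:R / _).
rewrite -cardsUI; set I := (_ :&: _)%SET; have -> : I = finset.set0.
  apply/setP => s; rewrite !inE /desc_pattern /=.
  by case: (has_descent s x); rewrite ?andbF.
rewrite cards0 addn0; apply: eq_card => s; rewrite !inE /desc_pattern /=.
by case: (has_descent s x); rewrite ?andbF //= orbF.
Qed.

(** Position [m] occurs in neither combined list; being free, it separates two independent
    blocks. *)
Lemma desc_prob_cat (R : realType) m l (A1 C1 A2 C2 : seq nat) :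
    {in A1 ++ C1, forall i, 0 < i < m}%N -> {in A2 ++ C2, forall i, 0 < i < l}%N ->
  desc_prob R (m + l) (A1 ++ map (addn m) A2) (C1 ++ map (addn m) C2) =
  desc_prob R m A1 C1 * desc_prob R l A2 C2.
Proof.
move=> in1 in2; have := card_desc_pattern_cat in1 in2.
rewrite /desc_prob => /(congr1 (fun k => k%:R : R)); rewrite !natrM => e.
have f0 k : k`!%:R != 0 :> R by rewrite pnatr_eq0 -lt0n fact_gt0.
rewrite mulf_div; apply/eqP; rewrite eqr_div ?mulf_neq0 // mulrC e mulrC.
by rewrite mulrC.
Qed.

Lemma desc_prob_ge0 (R : realType) n (A C : seq nat) : 0 <= desc_prob R n A C.
Proof. by rewrite divr_ge0. Qed.

(** * Hessenberg determinants and MacMahon's formula *)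

(** The first row is independent of [h], so that deleting the first column with either of the first
    two rows gives a determinant of the same shape. *)
Definition hess_det (R : comNzRingType) n (f : nat -> R) (h : nat -> nat -> R) : R :=
  \det (\matrix_(i < n.+1, j < n.+1) if i == 0 :> nat then f j else h i j).

Lemma eq_hess_det (R : comNzRingType) n (f f' : nat -> R) h h' :
    (forall j, (j <= n)%N -> f j = f' j) ->
    (forall i j, (i < n)%N -> (j <= n)%N -> h i.+1 j = h' i.+1 j) ->
  hess_det n f h = hess_det n f' h'.
Proof.
move=> ff hh; congr (\det _); apply/matrixP => i j; rewrite !mxE.
case: ifP => [_|]; first by rewrite ff // -ltnS.
by case: i => -[//|i] /= im _; rewrite hh // -ltnS.
Qed.

(* Expansion along the first column, only two entries of which are nonzero. *)
Lemma hess_detS (R : comNzRingType) n (f : nat -> R) h :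
    (forall i, (1 < i <= n.+1)%N -> h i 0%N = 0) ->
  hess_det n.+1 f h =
  f 0%N * hess_det n (fun j => h 1%N j.+1) (fun i j => h i.+1 j.+1) -
  h 1%N 0%N * hess_det n (fun j => f j.+1) (fun i j => h i.+1 j.+1).
Proof.
move=> h0; rewrite /hess_det (expand_det_col _ ord0) 2!big_ord_recl big1 ?addr0.
  rewrite !mxE /= /cofactor /= expr0 mul1r expr1 mulN1r mulrN.
  rewrite -[bump 0 0]/1%N; congr (_ * _ - _ * _); apply: (congr1 (@determinant _ _));
    apply/matrixP => i j; rewrite !mxE //=.
    by rewrite /bump /= !add1n /=; case: (i : nat).
  by case: i => -[|i] //= im; rewrite /bump /= !add1n.
by move=> i _; rewrite !mxE /= h0 ?mul0r //= /bump /=; have := ltn_ord i; lia.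
Qed.

Definition compl_in n (A : seq nat) : seq nat := [seq i <- iota 1 n.-1 | i \notin A].

(** Induction on the breakpoints with [s0] varying. A descent at [s1] is the pattern with [s1] free
    minus the one with an ascent at [s1]. The first factors at [s1], the second is the pattern of
    [L] seen from [s0]; these are the two terms of [hess_detS]. *)
Lemma macmahon_list (R : realType) (n s0 : nat) (L : seq nat) :
    path ltn s0 (rcons L n) ->
  let s := nth 0%N (s0 :: rcons L n) in
  hess_det (size L) (fun j => inv_fact R ((s j.+1)%:Z - (s 0%N)%:Z))
    (fun i j => inv_fact R ((s j.+1)%:Z - (s i)%:Z)) =
  let A := [seq (i - s0)%N | i <- L] in
  desc_prob R (n - s0) A (compl_in (n - s0) A).
Proof.
elim: L s0 => [|s1 L IHL] s0 /=.
  rewrite andbT => s0n; rewrite /hess_det det_mx11 mxE /= /compl_in.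
  rewrite (eq_filter (a2 := predT)) // filter_predT desc_prob_none.
  by rewrite subzn // ltnW.
move=> /andP[s01 pL]; set s := nth 0%N [:: s0, s1 & rcons L n].
have s1i : {in rcons L n, forall i, s1 < i}%N.
  by apply/allP; apply: order_path_min pL; apply: ltn_trans.
have s1n : (s1 < n)%N by apply: s1i; rewrite mem_rcons mem_head.
have s1L i : i \in L -> (s1 < i)%N.
  by move=> iL; apply: s1i; rewrite mem_rcons inE iL orbT.
have Ln : {in L, forall i, i < n}%N.
  move: (path_sorted pL); rewrite (sorted_pairwise ltn_trans) pairwise_rcons.
  by move=> /andP[/allP].
have p0L : path ltn s0 (rcons L n).
  by case: (L) pL => [|x L'] /= /andP[s1x p]; rewrite (ltn_trans s01 s1x).
rewrite hess_detS; last first.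
  move=> i /andP[i1 iL]; have : s i \in rcons L n.
    rewrite /s; case: i i1 iL => [//|[//|i]] _ /= iL; apply: mem_nth.
    by rewrite size_rcons ltnW.
  (* Beyond the second row the difference is negative, where [inv_fact] vanishes. *)
  move=> /s1i si; rewrite (_ : (s 1%N)%:Z - (s i)%:Z = Negz (s i - s1).-1) //.
  by rewrite NegzE /s /=; move: si; rewrite /s /=; lia.
have := IHL s1 pL => /= IH1; have := IHL s0 p0L => /= IH0.
rewrite [X in _ * X - _](_ : _ = desc_prob R (n - s1) [seq (i - s1)%N | i <- L]
  (compl_in (n - s1) [seq (i - s1)%N | i <- L])); last by rewrite -IH1.
rewrite [X in _ - _ * X](_ : _ = desc_prob R (n - s0) [seq (i - s0)%N | i <- L]
  (compl_in (n - s0) [seq (i - s0)%N | i <- L])); last first.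
  by rewrite -IH0; apply: eq_hess_det.
rewrite /s /= subrr /= invr1 mul1r.
pose a := (s1 - s0)%N; set m := (n - s0)%N; set A := [seq (i - s0)%N | i <- L].
pose C := compl_in m (a :: A).
have aA : a \notin A.
  by apply/mapP => -[i iL]; have := s1L _ iL; rewrite /a; lia.
(* Seen from [s0], the list [L] requires an ascent at [a]; this constraint is put in front for
   [desc_prob_cons]. *)
rewrite (@desc_prob_eq _ m A (compl_in m A) A (a :: C)) //; last first.
  move=> i; rewrite inE !mem_filter inE mem_iota negb_or.
  case: eqVneq => [->|_] //=; rewrite aA /a /m /=; lia.
rewrite desc_prob_cons opprB addrCA -[RHS]addr0; congr (_ + _).
apply/eqP; rewrite subr_eq0 subzn 1?ltnW //= -/a; apply/eqP/esym.
have mE : m = (a + (n - s1))%N by rewrite /m /a; lia.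
(* Now [a] is free: cutting there leaves an increasing block of [a] letters and the pattern of [L]
   seen from [s1]. *)
rewrite (@desc_prob_eq _ m A C ([::] ++ [seq (a + i)%N | i <- [seq (i - s1)%N | i <- L]])
    (iota 1 a.-1 ++ [seq (a + i)%N | i <- compl_in (n - s1) [seq (i - s1)%N | i <- L]])).
- rewrite mE desc_prob_cat ?desc_prob_none // => i.
    by rewrite mem_iota /=; lia.
  rewrite mem_cat mem_filter mem_iota => /orP[/mapP[j jL ->]|]; last by lia.
  by have := s1L _ jL; have := Ln _ jL; lia.
- rewrite /= -map_comp (_ : A = [seq (a + (i - s1))%N | i <- L]) //.
  by apply/eq_in_map => i iL; have := s1L _ iL; rewrite /a; lia.
- move=> i; rewrite mem_cat !mem_filter !mem_iota inE negb_or.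
  apply/idP/idP.
    move=> /andP[/andP[ia iA] im]; have [ltia|geia] := ltnP i a.
      by apply/orP; left; lia.
    apply/orP; right; apply/mapP; exists (i - a)%N; last by lia.
    rewrite mem_filter mem_iota; apply/andP; split; last by lia.
    apply: contra iA => /mapP[j jL ij]; apply/mapP; exists j => //.
    by have := s1L _ jL; move: ij ia geia; rewrite /a; lia.
  move=> /orP[ia|/mapP[j]].
    have -> : i != a by lia.
    have -> /= : i \notin A.
      by apply/mapP => -[j jL]; have := s1L _ jL; move: ia; rewrite /a; lia.
    by rewrite mE; lia.
  rewrite mem_filter mem_iota => /andP[jA jm] ->; rewrite mE.
  have -> : (a + j)%N != a by lia.
  suff -> /= : (a + j)%N \notin A by lia.
  apply: contra jA => /mapP[i' iL ij]; apply/mapP; exists i' => //.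
  by have := s1L _ iL; move: ij; rewrite /a; lia.
Qed.

(** An exact descent set is a pattern without free positions, to which [macmahon_list] applies with
    [s0 = 0]. *)
Lemma descent_law_det (R : realType) (n : nat) (S : {fset nat}) :
    (2 <= n)%N -> (forall s, s \in S -> (0 < s < n)%N) ->
  descent_law R n S = desc_prob R n (enum_fset S) (compl_in n (enum_fset S)) /\
  descent_law R n S = descent_det R n S.
Proof.
move=> n2 Sn.
have lawE : descent_law R n S =
    desc_prob R n (enum_fset S) (compl_in n (enum_fset S)).
  congr (_%:R / _); apply: eq_card => s; rewrite !inE.
  apply/eqP/andP => [sS|[/allP dS /allP dC]].
    split; apply/allP => i; rewrite -sS ?mem_filter !inE.
      by move=> /andP[].
    by move=> /andP[]; rewrite negb_and => /orP[/negP//|->].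
  apply/fsetP => i; rewrite !inE /=; apply/andP/idP => [[iI di]|iS].
    by apply: contraLR di => iS; apply: dC; rewrite mem_filter iS.
  by split; [have := Sn _ iS; rewrite mem_iota; lia | exact: dS].
split=> //; rewrite lawE /descent_det /breakpoints.
have memS : sort leq S =i enum_fset S by move=> i; rewrite mem_sort.
have pS : path ltn 0 (rcons (sort leq S) n).
  rewrite path_sortedE ?all_rcons; last exact: ltn_trans.
  rewrite /= (ltnW n2) (sorted_pairwise ltn_trans) pairwise_rcons
    -(sorted_pairwise ltn_trans).
  rewrite ltn_sorted_uniq_leq sort_uniq fset_uniq (sort_sorted leq_total) /=.
  by apply/andP; split; [|rewrite andbT]; apply/allP => i; rewrite mem_sort => /Sn/andP[].
have /= := macmahon_list R pS; rewrite subn0 => macE.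
transitivity (desc_prob R n [seq (i - 0)%N | i <- sort leq S]
    (compl_in n [seq (i - 0)%N | i <- sort leq S])).
  rewrite (eq_map (g := id)) ?map_id; last exact: subn0.
  apply: desc_prob_eq => i; first by rewrite memS.
  by rewrite !mem_filter memS.
rewrite -macE (_ : size (sort leq S) = #|` S|) ?size_sort //.
congr (\det _); apply/matrixP => i j; rewrite !mxE.
by case: (i : nat).
Qed.

(** * The kernel and its minors *)

(** Carrying the list of earlier values makes the recursion structural; the appended entry solves
    [kern_rec] for its last term. *)
Fixpoint kern_seq (R : realType) n : seq R :=
  if n is l.+1 then
    rcons (kern_seq R l) (l.+2`!%:R^-1 -
      \sum_(j < l) (kern_seq R l)`_j / (l.+1 - j)`!%:R)
  else [::].

Definition kern (R : realType) l : R := (kern_seq R l.+1)`_l.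

(* The Laurent coefficients of [1 / (1 - e^z)]. *)
Definition desc_kernel (R : realType) (m : int) : R :=
  match m with Posz l => kern R l | Negz 0 => -1 | Negz _ => 0 end.

Lemma size_kern_seq (R : realType) n : size (kern_seq R n) = n.
Proof. by elim: n => //= n IHn; rewrite size_rcons IHn. Qed.

Lemma nth_kern_seq (R : realType) n l : (l < n)%N -> (kern_seq R n)`_l = kern R l.
Proof.
elim: n => // n IHn; rewrite ltnS leq_eqVlt => /predU1P[->//|ln].
by rewrite -(IHn ln) /= nth_rcons size_kern_seq ln.
Qed.

(* Coefficient of [z ^ l.+1] in
   [(e^z - 1) * (kern 0 + kern 1 z + ...) = (e^z - 1 - z) / z]. *)
Lemma kern_rec (R : realType) l :
  \sum_(j < l.+1) kern R j / (l.+1 - j)`!%:R = l.+2`!%:R^-1.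
Proof.
rewrite big_ord_recr /= subSnn divr1 {2}/kern /= nth_rcons size_kern_seq ltnn eqxx.
rewrite addrC (eq_bigr (fun j : 'I_l => kern R j / (l.+1 - j)`!%:R)) ?subrK //.
by move=> j _; rewrite nth_kern_seq.
Qed.

Definition kminor (R : realType) (L : seq int) : R :=
  \det (\matrix_(i < size L, j < size L) desc_kernel R (L`_j - L`_i)).

(** The first row is based at an arbitrary point [c], as the expansion requires; taking for [c] the
    head of [L] gives back [kminor]. *)
Definition kdet (R : realType) c (L : seq int) : R :=
  hess_det (size L).-1 (fun j => desc_kernel R (L`_j - c))
    (fun i j => desc_kernel R (L`_j - L`_i)).

Lemma kminor_cons (R : realType) b L : kminor R (b :: L) = kdet R b (b :: L).
Proof. by congr (\det _); apply/matrixP => i j; rewrite !mxE; case: i => -[]. Qed.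

Lemma desc_kernel_lt_N1 (R : realType) (m : int) : m <= - 2 -> desc_kernel R m = 0.
Proof. by case: m => [|[|]]. Qed.

(** Points after [d] exceed [b] by at least 2, so the kernel vanishes in the first column below the
    second row. *)
Lemma kdet_cons (R : realType) c b d L : path <%R b (d :: L) ->
  kdet R c [:: b, d & L] =
  desc_kernel R (b - c) * kminor R (d :: L) - desc_kernel R (b - d) * kdet R c (d :: L).
Proof.
move=> /= /andP[bd dL]; rewrite /kdet /= hess_detS /= ?kminor_cons //.
case=> [|[|i]] //= iL; apply: desc_kernel_lt_N1.
have : L`_i \in L by rewrite mem_nth.
by move: (allP (order_path_min lt_trans dL) L`_i) => /[apply] /=; lia.
Qed.

Definition run (b : int) l : seq int := [seq b + i%:Z | i <- iota 0 l].
Arguments run : simpl never.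

Lemma runS b l : run b l.+1 = b :: run (b + 1) l.
Proof.
rewrite /run /= addr0; congr (_ :: _); rewrite -[1%N]addn0 iotaDl -map_comp.
by apply: eq_map => i /=; lia.
Qed.

Lemma size_run b l : size (run b l) = l.
Proof. by rewrite size_map size_iota. Qed.

Lemma mem_run b l x : (x \in run b l) = (b <= x < b + l%:Z).
Proof.
apply/mapP/idP => [[i + ->]|bx]; first by rewrite mem_iota; lia.
by exists `|x - b|%N; rewrite ?mem_iota; lia.
Qed.

Lemma sorted_run_cat b l rest : sorted <%R rest ->
  all (fun r => b + l%:Z < r) rest -> sorted <%R (run b l ++ rest).
Proof.
elim: l b => [|l IHl] b // srest brest; rewrite runS /=.
rewrite path_sortedE; last exact: lt_trans.
rewrite IHl ?andbT //; last by apply: sub_all brest => r; lia.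
rewrite all_cat; apply/andP; split; last by apply: sub_all brest => r; lia.
by apply/allP => x; rewrite mem_run; lia.
Qed.

(** Iteration of [kdet_cons]. Inside the run the subdiagonal entry is [-1], so all terms get a plus
    sign; after the run the gap makes this entry zero and the expansion stops. *)
Lemma kdet_run (R : realType) c b l rest : sorted <%R rest ->
    all (fun r => b + l.+1%:Z < r) rest ->
  kdet R c (run b l.+1 ++ rest) =
  \sum_(j < l.+1) desc_kernel R (b + j%:Z - c) *
    kminor R (run (b + j.+1%:Z) (l - j) ++ rest).
Proof.
elim: l b => [|l IHl] b srest brest.
  rewrite big_ord1 /= addr0; case: rest srest brest => [|d rest] srest brest.
    by rewrite /kdet /hess_det det_mx11 mxE /= /kminor det_mx00 mulr1.
  rewrite /= ?addr0 kdet_cons ?(@desc_kernel_lt_N1 _ (b - d)) ?mul0r ?subr0 //.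
    by move: brest => /= /andP[]; lia.
  by move: srest brest => /= -> /andP[bd _]; rewrite andbT; lia.
have brest' : all (fun r => b + 1 + l.+1%:Z < r) rest.
  by apply: sub_all brest => r; lia.
have := @sorted_run_cat b l.+2 rest srest brest.
rewrite [run b _]runS runS /= => srt.
rewrite kdet_cons // -[(b + 1 :: _)]/((_ :: _) ++ _) -runS IHl //.
rewrite (_ : b - (b + 1) = Negz 0); last by lia.
rewrite /= mulN1r opprK.
rewrite [RHS]big_ord_recl /= ; congr (_ + _).
  by congr (desc_kernel _ _ * _); lia.
apply: eq_bigr => j _;
  congr (desc_kernel _ _ * kminor _ (run _ _ ++ _)); rewrite /bump /=; lia.
Qed.

(** With [c = b] in [kdet_run] the remaining minors begin with shorter runs and are known by
    induction; the resulting sum is that of [kern_rec]. *)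
Lemma kminor_run (R : realType) b l rest : sorted <%R rest ->
    all (fun r => b + l%:Z < r) rest ->
  kminor R (run b l ++ rest) = l.+1`!%:R^-1 * kminor R rest.
Proof.
elim/ltn_ind: l b => -[|l] IHl b srest brest; first by rewrite invr1 mul1r.
have := @kdet_run R b b l rest srest brest.
rewrite {1 2}runS /= -kminor_cons => ->.
rewrite -kern_rec mulr_suml; apply: eq_bigr => j _.
rewrite IHl //; [|by have := ltn_ord j; lia|]; last first.
  by apply: sub_all brest => r; have := ltn_ord j; lia.
have jl : (j <= l)%N by rewrite -ltnS.
by rewrite mulrA subSn // (_ : b + j%:Z - b = j) //; lia.
Qed.

(** Rows and columns undergo the same permutation, so its sign appears squared. *)
Lemma kminor_perm (R : realType) (s t : seq int) :
  perm_eq s t -> kminor R s = kminor R t.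
Proof.
move=> st.
have kE u : size u = size t ->
    kminor R u = \det (\matrix_(i < size t, j < size t) desc_kernel R (u`_j - u`_i)).
  by rewrite /kminor => ->.
have /tuple_permP[p sE] : perm_eq s (in_tuple t) by [].
rewrite (kE s) ?(perm_size st) // (kE t) //.
have -> : \matrix_(i < size t, j < size t) desc_kernel R (s`_j - s`_i) =
    row_perm p (col_perm p (\matrix_(i, j) desc_kernel R (t`_j - t`_i))).
  apply/matrixP => i j; rewrite !mxE sE.
  by rewrite -!tnth_nth !tnth_mktuple !(tnth_nth 0).
rewrite row_permE col_permE !det_mulmx !det_perm odd_permV mulrCA -expr2.
by rewrite sqrr_sign mulr1.
Qed.

Lemma kminor_shift (R : realType) t (s : seq int) :
  kminor R [seq x + t | x <- s] = kminor R s.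
Proof.
rewrite /kminor size_map; congr (\det _); apply/matrixP => i j; rewrite !mxE.
by rewrite !(nth_map 0) // opprD addrACA subrr addr0.
Qed.

(** The strict bound leaves [b + l.+1] empty, which makes the first run maximal. *)
Lemma run_decomposition (L : seq int) : sorted <%R L -> L != [::] ->
  exists b l rest, [/\ L = run b l.+1 ++ rest, sorted <%R rest &
    all (fun r => b + l.+1%:Z < r) rest].
Proof.
elim: L => // b [|d L] IHL sL _.
  by exists b, 0%N, [::]; rewrite runS.
have /andP[bd dL] : (b < d) && path <%R d L := sL.
have [//|//|b' [l [rest [LE srest lrest]]]] := IHL.
have b'E : b' = d by move: LE; rewrite runS => -[].
have [dE|db] := eqVneq d (b + 1).
  exists b, l.+1, rest; rewrite LE [run b _]runS b'E dE; split=> //.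
  by apply: sub_all lrest => r; lia.
exists b, 0%N, (d :: L); split=> //=; first by rewrite addr0.
apply/andP; split; first by lia.
by apply: sub_all (order_path_min lt_trans dL) => r /=; lia.
Qed.

(** * Kernel minors as descent probabilities, and their factorization *)

Lemma desc_prob_nil (R : realType) n : desc_prob R n [::] [::] = 1.
Proof.
rewrite /desc_prob (_ : finset _ = [set: 'S_n]%SET) ?cardsT ?card_Sn.
  by rewrite divff // pnatr_eq0 -lt0n fact_gt0.
by apply/setP => s; rewrite !inE.
Qed.

(** The first [p] letters are unconstrained and split off by [desc_prob_cat]; the other [l.+1] must
    decrease. *)
Lemma desc_prob_run (R : realType) p l :
  desc_prob R (p + l.+1) (iota p.+1 l) [::] = (l.+1`!%:R)^-1.
Proof.
have := @desc_prob_cat R p l.+1 [::] [::] (iota 1 l) [::].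
rewrite desc_prob_nil mul1r -iotaDl addn1 (@desc_prob_all _ l.+1) /=; apply => // i.
by rewrite cats0 mem_iota; lia.
Qed.

(** Both sides are multiplicative over maximal runs and agree on each, so the first run is removed
    by induction on the number of points. *)
Lemma kminor_desc_prob (R : realType) a n (L : seq int) : sorted <%R L ->
    all (fun x => a < x < a + n%:Z) L ->
  kminor R L = desc_prob R n [seq `|x - a|%N | x <- L] [::].
Proof.
have [N] := ubnP (size L); elim: N L a n => // N IHN L a n LN sL Lan.
have [->|/(run_decomposition sL)[b [l [rest [LE srest lrest]]]]] := eqVneq L [::].
  by rewrite desc_prob_nil /kminor det_mx00.
move: LN Lan; rewrite {sL}LE size_cat all_cat size_run => LN /andP[Lrun Lrest].
have /andP[ab _] : a < b < a + n%:Z by move: Lrun; rewrite runS => /andP[].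
have bn : b + l%:Z < a + n%:Z.
  have /(allP Lrun)/andP[] // : b + l%:Z \in run b l.+1.
  by rewrite mem_run; lia.
(* [a + m] is [b + l.+1], just after the run; the first block has [p] letters followed by the [l.+2]
   letters compared in the run. *)
pose p := `|b - a|.-1%N; pose m := (p + l.+2)%N.
have mn : (m <= n)%N by rewrite /m /p; lia.
rewrite kminor_run // (IHN rest (a + m%:Z) (n - m)%N) //; last 2 first.
- by move: LN; lia.
- apply/allP => x xrest; have := allP lrest _ xrest; have := allP Lrest _ xrest.
  by rewrite /m /p /=; lia.
rewrite -(desc_prob_run R p) -[(p + _)%N]/m map_cat.
set A1 := iota _ _; set A2 := [seq _ | x <- rest].
transitivity (desc_prob R (m + (n - m)) (A1 ++ [seq (m + i)%N | i <- A2])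
    ([::] ++ [seq (m + i)%N | i <- [::]])); last first.
  rewrite subnKC //; apply: desc_prob_eq => // i; congr (i \in _ ++ _).
    rewrite /A1 /run -map_comp -[p.+1]addn0 iotaDl; apply/eq_in_map => j _ /=.
    by rewrite /p; lia.
  rewrite /A2 -map_comp; apply/eq_in_map => x xrest /=.
  by have := allP lrest _ xrest; rewrite /m /p /=; lia.
rewrite desc_prob_cat // => i; rewrite cats0.
  by rewrite mem_iota /m; lia.
move=> /mapP[x xrest ->]; have := allP lrest _ xrest; have := allP Lrest _ xrest.
by rewrite /m /p /=; lia.
Qed.

(** Neighbouring points cannot lie in different lists, so each maximal run of the union is contained
    in one of them. Removing the first run takes the same factor out of both sides. *)
Lemma kminor_cat (R : realType) (X Y : seq int) : uniq (X ++ Y) ->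
    (forall x y, x \in X -> y \in Y -> 2 <= `|x - y|) ->
  kminor R (X ++ Y) = kminor R X * kminor R Y.
Proof.
have [N] := ubnP (size (X ++ Y)); elim: N X Y => // N IHN.
(* By symmetry the smallest point [b] may be taken in [X]. *)
suff step (X Y : seq int) b l rest : (size (X ++ Y) < N.+1)%N -> uniq (X ++ Y) ->
    (forall x y, x \in X -> y \in Y -> 2 <= `|x - y|) ->
    sort <=%R (X ++ Y) = run b l.+1 ++ rest ->
    sorted <%R rest -> all (fun r => b + l.+1%:Z < r) rest -> b \in X ->
  kminor R (X ++ Y) = kminor R X * kminor R Y.
  move=> X Y szXY uXY dXY.
  have [XY0|XY0] := eqVneq (X ++ Y) [::].
    by move: XY0; case: X {szXY uXY dXY} => //= ->; rewrite /kminor det_mx00 mul1r.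
  have sXY : sorted <%R (sort <=%R (X ++ Y)).
    by rewrite lt_sorted_uniq_le sort_uniq uXY sort_sorted //; apply: le_total.
  have [|b [l [rest [e srest lrest]]]] := run_decomposition sXY.
    by rewrite -size_eq0 size_sort size_eq0.
  have : b \in X ++ Y by rewrite -(mem_sort <=%R) e runS mem_head.
  rewrite mem_cat => /orP[bX|bY]; first exact: (step X Y b l rest).
  rewrite (@kminor_perm _ _ (Y ++ X)); last by rewrite perm_catC.
  rewrite mulrC.
  apply: (step Y X b l rest) => //.
  - by rewrite size_cat addnC -size_cat.
  - by rewrite uniq_catC.
  - by move=> x y xY yX; rewrite distrC; apply: dXY.
  - rewrite -e; apply/perm_sortP; [exact: le_total|exact: le_trans|exact: le_anti|].
    by rewrite perm_catC.
move=> szXY uXY dXY e srest lrest bX.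
have XYE x : (x \in X) || (x \in Y) = (x \in run b l.+1) || (x \in rest).
  by rewrite -!mem_cat -e mem_sort.
(* Going up the run, each new point is at distance 1 from a point of [X], hence is not in [Y]. *)
have runX : {subset run b l.+1 <= X}.
  move=> x; rewrite mem_run => bx; have -> : x = b + `|x - b|%N%:Z by lia.
  have : (`|x - b| < l.+1)%N by lia.
  elim: `|x - b|%N => [|i IHi] il; first by rewrite addr0.
  have : (b + i.+1%:Z \in X) || (b + i.+1%:Z \in Y) by rewrite XYE mem_run; lia.
  by move=> /orP[//|bY]; have := dXY _ _ (IHi (ltnW il)) bY; lia.
pose X' := [seq x <- X | x \notin run b l.+1].
have Xrest x : x \in X' ++ Y = (x \in rest).
  rewrite mem_cat mem_filter; have := XYE x.
  have := allP lrest x; have : x \in run b l.+1 -> x <= b + l%:Z.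
    by rewrite mem_run; lia.
  have := runX x; case: (x \in run _ _) => [/(_ isT) xX /(_ isT) xb xr|_ _ _ /= <-//].
  rewrite xX /= => _; have -> : x \in rest = false.
    by apply/negP => /xr; lia.
  by apply/negP => xY; have := dXY _ _ xX xY; rewrite subrr.
have uX' : uniq (X' ++ Y).
  by apply: subseq_uniq uXY; apply: cat_subseq => //; apply: filter_subseq.
have urest : uniq rest by move: srest; rewrite lt_sorted_uniq_le => /andP[].
have sX' : sorted <%R (sort <=%R X').
  rewrite lt_sorted_uniq_le sort_uniq sort_sorted //; last exact: le_total.
  by move: uX'; rewrite cat_uniq => /andP[->].
have -> : kminor R (X ++ Y) = l.+2`!%:R^-1 * (kminor R X' * kminor R Y).
  rewrite -(@kminor_perm R (run b l.+1 ++ rest) (X ++ Y)); last by rewrite -e perm_sort.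
  rewrite kminor_run // -IHN //.
  - by congr (_ * _); apply: kminor_perm; apply: uniq_perm => // x; rewrite Xrest.
  - rewrite -ltnS; apply: leq_trans szXY; rewrite ltnS.
    have -> : size (X ++ Y) = size (run b l.+1 ++ rest) by rewrite -e size_sort.
    rewrite (@perm_size _ (X' ++ Y) rest); last by apply: uniq_perm => // x; rewrite Xrest.
    by rewrite size_cat size_run addSn ltnS leq_addl.
  - by move=> x y; rewrite mem_filter => /andP[_]; apply: dXY.
rewrite mulrA; congr (_ * _).
rewrite -(@kminor_perm R (run b l.+1 ++ sort <=%R X') X) ?kminor_run //.
- by congr (_ * _); apply: kminor_perm; rewrite perm_sym perm_sort.
- apply/allP => x; rewrite mem_sort => xX'; apply: (allP lrest).
  by rewrite -Xrest mem_cat xX'.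
have urun : uniq (run b l.+1).
  have : uniq (run b l.+1 ++ rest) by rewrite -e sort_uniq.
  by rewrite cat_uniq => /andP[].
apply: uniq_perm.
- rewrite cat_uniq urun sort_uniq filter_uniq ?andbT /=.
    by apply/hasPn => x; rewrite mem_sort mem_filter => /andP[].
  by move: uXY; rewrite cat_uniq => /andP[].
- by move: uXY; rewrite cat_uniq => /andP[].
move=> x; rewrite mem_cat mem_sort mem_filter.
by have := runX x; case: (x \in run _ _) => // /(_ isT) ->.
Qed.

(** * Cylinder events and inclusion-exclusion *)

Section CylinderEvents.
Variable (X : choiceType).

Definition cylinder (A : {fset X}) (c : seq X) : set (configuration X) :=
  [set S : set X | (forall x, x \in A -> S x) /\ (forall x, x \in c -> ~ S x)].

Lemma measurable_occupied (x : X) :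
  measurable (occupied x : set (configuration X)).
Proof. by apply: sub_sigma_algebra; exists x. Qed.

Lemma measurable_cylinder A c : measurable (cylinder A c).
Proof.
rewrite (_ : cylinder A c = (\bigcap_(x in [set` A]) occupied x) `&`
    \bigcap_(x in [set` c]) ~` occupied x).
  apply: measurableI; apply: fin_bigcap_measurable => // x _.
    exact: measurable_occupied.
  by apply: measurableC; apply: measurable_occupied.
by apply/seteqP; split.
Qed.

Variables (R : realType) (rho : {fset X} -> R).

(* If [rho] is the correlation function of [S], this is the probability that
   [S] contains [A] and avoids [c]. *)
Fixpoint sieve (A : {fset X}) (c : seq X) : R :=
  if c is x :: c' then sieve A c' - sieve (x |` A)%fset c' else rho A.

Lemma sieve_cons A x c : sieve A c = sieve A (x :: c) + sieve (x |` A)%fset c.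
Proof. by rewrite [sieve A (_ :: _)]/sieve -/sieve subrK. Qed.

Lemma measure_cylinder_cons (P : probability (configuration X) R) A x c :
  P (cylinder A c) = (P (cylinder A (x :: c)) + P (cylinder (x |` A)%fset c))%E.
Proof.
rewrite -measureU; [|exact: measurable_cylinder|exact: measurable_cylinder|].
  congr (P _); apply/seteqP; split=> S /=.
    move=> [SA Sc]; have [Sx|Sx] := pselect (S x).
      by right; split=> // y; rewrite in_fset1U => /predU1P[->|/SA].
    by left; split=> // y; rewrite in_cons => /predU1P[->|/Sc].
  move=> [[SA Sc]|[SA Sc]]; split=> // y yI.
    by apply: Sc; rewrite in_cons yI orbT.
  by apply: SA; rewrite in_fset1U yI orbT.
apply/seteqP; split=> S //= [[_ Sc] [SA _]].
by apply: (Sc x); [rewrite mem_head|apply: SA; rewrite in_fset1U eqxx].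
Qed.

Lemma measure_cylinder (P : probability (configuration X) R) A c :
    (forall B, P (cylinder B [::]) = (rho B)%:E) ->
  P (cylinder A c) = (sieve A c)%:E.
Proof.
move=> PE; elim: c A => [|x c IHc] A; first exact: PE.
have := measure_cylinder_cons P A x c; rewrite !IHc (sieve_cons A x) EFinD.
by move=> /(congr1 (fun y => y - (sieve (x |` A)%fset c)%:E)%E); rewrite !addeK.
Qed.

Lemma correlationE (P : point_process X R) A :
  correlation P A = P (cylinder A [::]).
Proof. by congr (P _); apply/seteqP; split=> S /=; [split|case]. Qed.

End CylinderEvents.
Arguments sieve : simpl never.

(** * Construction of a process from its correlation function *)

Section Uniform01.
Variable R : realType.

(** The interval is half-open because it is cut repeatedly into half-open pieces. *)
Definition uniform01 := mrestr (@lebesgue_measure R) (measurable_itv `[(0:R), 1[).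

HB.instance Definition _ := Measure.on uniform01.

Let uniform01_setT : uniform01 setT = 1%E.
Proof. by rewrite /uniform01 /mrestr setTI lebesgue_measure_itv /= lte01 oppr0 adde0. Qed.

HB.instance Definition _ := Measure_isProbability.Build _ _ _ uniform01 uniform01_setT.

End Uniform01.

(* A uniform variable [t] is read as an infinite sequence of bits: the interval
   of the node [w] is cut into two pieces, the lengths of which are the
   probabilities that the next point [e j] is absent or present. *)
Section Existence.
Variables (X : choiceType) (e : nat -> X) (idx : X -> nat).
Hypotheses (eK : cancel e idx) (idxK : cancel idx e).
Variables (R : realType) (rho : {fset X} -> R).
Hypotheses (rho0 : rho fset0 = 1) (sieve_ge0 : forall A c, 0 <= sieve rho A c).

(** The latest bit is the head of [w], so [size w] indexes the next point to decide. The triple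
    holds the points present, the points absent and the left endpoint; the piece for an absent point
    lies on the left. *)
Fixpoint node (w : seq bool) : {fset X} * seq X * R :=
  if w is b :: w' then
    let: (A, c, F) := node w' in let x := e (size w') in
    if b then ((x |` A)%fset, c, F + sieve rho A (x :: c)) else (A, x :: c, F)
  else (fset0, [::], 0).

Definition node_in w := (node w).1.1.
Definition node_out w := (node w).1.2.
Definition node_inf w := (node w).2.
Definition node_prob w := sieve rho (node_in w) (node_out w).
Definition node_mid w := node_inf w + sieve rho (node_in w) (e (size w) :: node_out w).

Lemma node_cons b w : node (b :: w) =
  if b then ((e (size w) |` node_in w)%fset, node_out w, node_mid w)
  else (node_in w, e (size w) :: node_out w, node_inf w).
Proof.
rewrite /= /node_mid /node_in /node_out /node_inf.
by case: (node w) => -[A c] F; case: b.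
Qed.

Lemma node_in_cons b w :
  node_in (b :: w) = if b then (e (size w) |` node_in w)%fset else node_in w.
Proof. by rewrite {1}/node_in node_cons; case: b. Qed.

Lemma node_out_cons b w :
  node_out (b :: w) = if b then node_out w else e (size w) :: node_out w.
Proof. by rewrite {1}/node_out node_cons; case: b. Qed.

Lemma node_inf_cons b w : node_inf (b :: w) = if b then node_mid w else node_inf w.
Proof. by rewrite {1}/node_inf node_cons; case: b. Qed.

(** Nonnegativity of both sieves places [node_mid] within the interval of [w], which it cuts into
    those of the two children. *)
Lemma node_interval_cons b w t :
  (node_inf (b :: w) <= t < node_inf (b :: w) + node_prob (b :: w)) =
  (node_inf w <= t < node_inf w + node_prob w) && (b == (node_mid w <= t)).
Proof.
have p_ge0 := sieve_ge0 (node_in w) (e (size w) :: node_out w).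
have q_ge0 := sieve_ge0 (e (size w) |` node_in w)%fset (node_out w).
have := sieve_cons rho (node_in w) (e (size w)) (node_out w).
rewrite /node_prob node_inf_cons node_in_cons node_out_cons /node_mid.
case: b => /=; move: p_ge0 q_ge0.
  move: (sieve rho _ (_ :: _)) (sieve rho (_ |` _)%fset _) => p q p_ge0 q_ge0 ->.
  apply/idP/idP => [/andP[h1 h2]|/andP[/andP[h1 h2] /eqP h3]].
    by rewrite h1 eqxx andbT; apply/andP; split; lra.
  by rewrite -h3; lra.
move: (sieve rho _ (_ :: _)) (sieve rho (_ |` _)%fset _) => p q p_ge0 q_ge0 ->.
apply/idP/idP => [/andP[h1 h2]|/andP[/andP[h1 h2] /eqP h3]].
  by rewrite h1 [X in _ == X]leNgt h2 eqxx andbT /=; lra.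
by rewrite h1 ltNge -h3.
Qed.

Fixpoint bits (t : R) n : seq bool :=
  if n is m.+1 then (node_mid (bits t m) <= t) :: bits t m else [::].

Lemma size_bits t n : size (bits t n) = n.
Proof. by elim: n => //= n ->. Qed.

Lemma bits_interval t w : 0 <= t < 1 ->
  (bits t (size w) == w) = (node_inf w <= t < node_inf w + node_prob w).
Proof.
move=> t01; elim: w => [|b w IHw].
  by rewrite /node_inf /node_prob /sieve /= rho0 add0r t01 eqxx.
rewrite node_interval_cons -IHw /= eqseq_cons andbC; case: eqP => //= ->.
by rewrite eq_sym.
Qed.

Lemma measurable_bits w : measurable [set t | bits t (size w) = w].
Proof.
elim: w => [|b w IHw] /=.
  by rewrite (_ : [set _ | _] = setT) //; apply/seteqP; split.
rewrite (_ : [set _ | _] = [set t | bits t (size w) = w] `&`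
    (if b then `[node_mid w, +oo[%classic else `]-oo, node_mid w[%classic)).
  by apply: measurableI => //; case: b; apply: measurable_itv.
apply/seteqP; split=> t /=.
  by case=> <- bw; rewrite bw; split=> //; case: leP; rewrite /= in_itv /= ?andbT.
by case=> bw; rewrite bw; case: b; rewrite /= in_itv /= ?andbT => tm; rewrite ?tm ?leNgt ?tm.
Qed.

(** The point [x] is decided at step [idx x], whose bit is the head of the first [(idx x).+1]
    bits. *)
Definition random_set (t : measurableTypeR R) : configuration X :=
  [set x | head false (bits t (idx x).+1)].

Lemma measurable_random_set : measurable_fun setT random_set.
Proof.
apply: (@measurability _ _ _ (configuration X) setT random_set
  (range (@occupied X)) erefl) => // _ [_ [x _ <-] <-].
(* The bits before the one deciding [x] are arbitrary, which gives a finite union over words of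
   length [idx x]. *)
rewrite setTI (_ : _ @^-1` _ =
    \bigcup_(w in [set w : (idx x).-tuple bool | true])
      [set t | bits t (size (true :: val w)) = true :: val w]).
  by apply: fin_bigcup_measurable => // w _; apply: measurable_bits.
apply/seteqP; split=> t /=.
  rewrite /occupied /random_set /= => tx.
  exists (Tuple (introT eqP (size_bits t (idx x)))) => //=.
  by rewrite size_bits tx.
by move=> [w _]; rewrite /occupied /random_set /= size_tuple => -[-> _].
Qed.

HB.instance Definition _ := isMeasurableFun.Build _ _ _ _ random_set measurable_random_set.

Definition sieve_process : point_process X R :=
  distribution (@uniform01 R)
    [the {mfun measurableTypeR R >-> configuration X} of random_set].

(** The points decided along [w] are the first [size w] ones, so the event prescribes exactly these
    bits. *)
Lemma cylinder_node w t :
  cylinder (node_in w) (node_out w) (random_set t) <-> bits t (size w) = w.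
Proof.
elim: w => [|b w IHw]; first by split=> // _; split.
have -> : cylinder (node_in (b :: w)) (node_out (b :: w)) (random_set t) <->
    cylinder (node_in w) (node_out w) (random_set t) /\
    (b = head false (bits t (size w).+1)).
  have xE : random_set t (e (size w)) = head false (bits t (size w).+1).
    by rewrite /random_set /= eK.
  rewrite node_in_cons node_out_cons; split.
    case: b => /= -[tA tc]; split.
    - by split=> // y yA; apply: tA; rewrite in_fset1U yA orbT.
    - by have := tA (e (size w)); rewrite in_fset1U eqxx xE /= => ->.
    - by split=> // y yc; apply: tc; rewrite in_cons yc orbT.
    - by have := tc (e (size w)); rewrite mem_head xE /= => /(_ isT)/negP/negbTE.
  move=> [[tA tc]]; case: b => /= bE; split=> // y.
    by rewrite in_fset1U => /predU1P[->|/tA //]; rewrite xE /= -bE.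
  by rewrite in_cons => /predU1P[->|/tc //]; rewrite xE /= -bE.
rewrite IHw /=; split=> [[-> ->] //|[bE wE]].
by rewrite bE.
Qed.

Lemma sieve_process_node w :
  sieve_process (cylinder (node_in w) (node_out w)) = (node_prob w)%:E.
Proof.
rewrite /sieve_process /= /distribution /pushforward /uniform01 /= /mrestr.
rewrite (_ : _ `&` _ = `[node_inf w, node_inf w + node_prob w[%classic).
  rewrite lebesgue_measure_itv /= lte_fin ltrDl.
  case: ltgtP (sieve_ge0 (node_in w) (node_out w)) => // [_ _|<- _]; last by [].
  by rewrite -EFinB addrC addKr.
(* The interval of a node stays within [[0, 1[], so restricting Lebesgue measure does not change its
   length. *)
have inf01 : 0 <= node_inf w /\ node_inf w + node_prob w <= 1.
  elim: w => [|b w [inf_ge0 sup_le1]].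
    by rewrite /node_inf /node_prob /sieve /= rho0 add0r lexx.
  have p_ge0 := sieve_ge0 (node_in w) (e (size w) :: node_out w).
  have q_ge0 := sieve_ge0 (e (size w) |` node_in w)%fset (node_out w).
  move: sup_le1; rewrite /node_prob node_inf_cons node_in_cons node_out_cons /node_mid.
  by rewrite (sieve_cons rho (node_in w) (e (size w))); case: b => *; split; lra.
apply/seteqP; split=> t /=; rewrite !in_itv /=.
  by move=> [/cylinder_node tw t01]; rewrite -bits_interval ?tw.
move=> tw; have t01 : 0 <= t < 1 by move: inf01 tw => [? ?]; lra.
by split=> //; apply/cylinder_node/eqP; rewrite bits_interval.
Qed.

(** The first [N] points include [A]. Starting from the root, undecided points are settled one at a
    time until the event is that of a node; [B] holds the required points still to come. *)
Lemma sieve_process_correlation A : correlation sieve_process A = (rho A)%:E.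
Proof.
rewrite correlationE; pose N := (\max_(x : A) idx (val x)).+1.
have AN x : x \in A -> (idx x < N)%N.
  by move=> xA; rewrite ltnS; apply: (leq_bigmax (F := fun x : A => idx (val x)) [` xA]%fset).
suff main n w (B : {fset X}) : (size w + n = N)%N ->
    (forall x, x \in B -> size w <= idx x < N)%N ->
    sieve_process (cylinder (node_in w `|` B)%fset (node_out w)) =
    (sieve rho (node_in w `|` B)%fset (node_out w))%:E.
  have := main N [::] A; rewrite fset0U; apply => // x /AN ->.
elim: n w B => [|n IHn] w B wN BN.
  suff -> : B = fset0 by rewrite fsetU0 sieve_process_node.
  by apply/fsetP => x; rewrite in_fset0; apply/negP => /BN; rewrite -wN; lia.
pose x := e (size w).
have Bx y : y \in B -> y != x -> (size w < idx y < N)%N.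
  move=> /BN/andP[wy ->] yx; rewrite andbT ltn_neqAle wy andbT.
  by apply: contraNneq yx => wy'; rewrite /x wy' idxK.
(* If [x] is required only the child containing it is followed; otherwise the event is split over
   both children. *)
have [xB|xB] := boolP (x \in B).
  have := IHn (true :: w) (B `\ x)%fset; rewrite !node_in_cons !node_out_cons.
  have -> : ((x |` node_in w) `|` (B `\ x) = node_in w `|` B)%fset.
    apply/fsetP => y; rewrite !inE; case: eqVneq => [->|] //=.
    by rewrite xB orbT.
  apply; first by rewrite /= -wN; lia.
  by move=> y; rewrite !inE => /andP[yx yB]; apply: Bx.
rewrite (measure_cylinder_cons _ _ x).
have := IHn (true :: w) B; have := IHn (false :: w) B.
rewrite !node_in_cons !node_out_cons -fsetUA => -> //.
- move=> -> //; first by rewrite -EFinD -sieve_cons.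
    by rewrite /= -wN; lia.
  by move=> y yB; apply: Bx => //; apply: contraNneq xB => <-.
- by rewrite /= -wN; lia.
by move=> y yB; apply: Bx => //; apply: contraNneq xB => <-.
Qed.

End Existence.

(** * Uniqueness from correlations, and translations *)

(** The events of containing a given finite set are stable under intersection and generate the
    sigma-algebra. *)
Lemma point_process_unique (X : choiceType) (R : realType) (P Q : point_process X R) :
    (forall A, correlation P A = correlation Q A) ->
  forall E, measurable E -> P E = Q E.
Proof.
move=> PQ E mE.
apply: (measure_unique (range (fun A : {fset X} => cylinder A [::]))
  (fun=> cylinder fset0 [::])) => //.
- apply/seteqP; split; apply: smallest_sub; try exact: smallest_sigma_algebra.
    move=> _ [x _ <-]; apply: sub_sigma_algebra; exists [fset x]%fset => //.
    apply/seteqP; split=> S /=; first by case=> Sx _; apply: Sx; rewrite in_fset1.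
    by move=> Sx; split=> // y; rewrite in_fset1 => /eqP->.
  by move=> _ [A _ <-]; apply: measurable_cylinder.
- move=> _ _ [A _ <-] [B _ <-]; exists (A `|` B)%fset => //.
  apply/seteqP; split=> S /=.
    by case=> SAB _; split; split=> // x xI; apply: SAB; rewrite in_fsetU xI ?orbT.
  by case=> -[SA _] [SB _]; split=> // x; rewrite in_fsetU => /orP[/SA|/SB].
- by apply/seteqP; split=> // S _; exists 0%N => //; split.
- by move=> _ [A _ <-]; have := PQ A; rewrite !correlationE.
- move=> _; apply: (le_lt_trans (probability_le1 _ _)); rewrite ?ltry //.
  exact: measurable_cylinder.
Qed.

Lemma measurable_translate t : measurable_fun setT (translate t).
Proof.
apply: (@measurability _ _ (configuration int) (configuration int) setT (translate t)
  (range (@occupied int)) erefl) => _ [_ [x _ <-] <-].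
rewrite setTI (_ : _ @^-1` _ = occupied (x - t)); first exact: measurable_occupied.
apply/seteqP; split=> S; rewrite /translate /occupied /=.
  by case=> y Sy <-; rewrite addrK.
by move=> Sx; exists (x - t) => //; rewrite subrK.
Qed.

HB.instance Definition _ t :=
  isMeasurableFun.Build _ _ _ _ (translate t) (measurable_translate t).

(** * The descent process on the integers *)

Section DescentProcess.
Variable R : realType.

Definition rho (A : {fset int}) : R := kminor R A.

Lemma rho_window a n (A : {fset int}) : {in A, forall x, a < x < a + n%:Z} ->
  rho A = desc_prob R n [seq `|x - a|%N | x <- A] [::].
Proof.
move=> An; rewrite /rho -(@kminor_perm _ (sort <=%R A)) ?perm_sort //.
rewrite (kminor_desc_prob _ (a := a) (n := n)).
- by apply: desc_prob_eq => // i; apply: perm_mem; apply: perm_map; rewrite perm_sort.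
- by rewrite lt_sorted_uniq_le sort_uniq fset_uniq sort_sorted //; apply: le_total.
by apply/allP => x; rewrite mem_sort => /An.
Qed.

(** Both sides obey the same inclusion-exclusion recursion, [sieve_cons] and [desc_prob_cons]. *)
Lemma sieve_window a n (A : {fset int}) (c : seq int) :
    {in A, forall x, a < x < a + n%:Z} -> {in c, forall x, a < x < a + n%:Z} ->
  sieve rho A c = desc_prob R n [seq `|x - a|%N | x <- A] [seq `|x - a|%N | x <- c].
Proof.
elim: c A => [|x c IHc] A An cn; first exact: rho_window.
have cn' : {in c, forall y, a < y < a + n%:Z}.
  by move=> y yc; apply: cn; rewrite in_cons yc orbT.
have := sieve_cons rho A x c; rewrite !IHc //.
  rewrite /= desc_prob_cons => ->; rewrite -[LHS]addr0 -[RHS]addrA; congr (_ + _).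
  apply/esym/eqP; rewrite subr_eq0; apply/eqP; apply: desc_prob_eq => // i.
  apply/mapP/idP => [[y + ->]|].
    rewrite in_fset1U in_cons => /predU1P[->|yA]; first by rewrite eqxx.
    by apply/orP; right; apply/mapP; exists y.
  rewrite in_cons => /predU1P[->|/mapP[y yA ->]].
    by exists x => //; rewrite in_fset1U eqxx.
  by exists y => //; rewrite in_fset1U yA orbT.
move=> y; rewrite in_fset1U => /predU1P[->|/An //].
by apply: cn; rewrite mem_head.
Qed.

Lemma sieve_rho_ge0 A c : 0 <= sieve rho A c.
Proof.
pose M := (\max_(x <- enum_fset A ++ c) `|x|)%N.
have Mle x : x \in enum_fset A ++ c -> (`|x| <= M)%N.
  by move=> xI; apply: (@leq_bigmax_seq _ _ xpredT (fun x : int => `|x|%N)).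
(* All points lie strictly between [- M.+1] and [M.+1], a window in which the sieve is a
   probability. *)
rewrite (@sieve_window (- M.+1%:Z) (2 * M.+1)) ?desc_prob_ge0 // => x xI.
  by have := Mle x; rewrite mem_cat xI => /(_ isT); lia.
by have := Mle x; rewrite mem_cat xI orbT => /(_ isT); lia.
Qed.

(** The enumeration [0, -1, 1, -2, ...], giving the order in which points are decided. *)
Definition nat_int (n : nat) : int := if odd n then Negz n./2 else Posz n./2.
Definition int_nat (z : int) : nat := match z with Posz n => n.*2 | Negz n => n.*2.+1 end.

Lemma nat_intK : cancel nat_int int_nat.
Proof.
move=> n; rewrite /nat_int -[RHS]odd_double_half.
by case: odd; rewrite ?add1n ?add0n.
Qed.

Lemma int_natK : cancel int_nat nat_int.
Proof.
case=> n; rewrite /nat_int /= odd_double /=; first by rewrite doubleK.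
by rewrite uphalf_double.
Qed.

Lemma rho_fset0 : rho fset0 = 1.
Proof. by rewrite /rho (size0nil (cardfs0 _)) /kminor det_mx00. Qed.

Definition descent_process : point_process int R :=
  sieve_process nat_int int_nat rho.

Lemma descent_process_correlation A : correlation descent_process A = (rho A)%:E.
Proof. exact: (sieve_process_correlation nat_intK int_natK rho_fset0 sieve_rho_ge0). Qed.

(** By uniqueness it suffices to compare correlations, and the minors depend on differences only. *)
Lemma descent_process_stationary : stationary descent_process.
Proof.
move=> t E mE.
pose Q := distribution descent_process
  [the {mfun configuration int >-> configuration int} of translate t].
apply: (@point_process_unique int R [the probability _ _ of Q] descent_process) => // A.
(* The translate by [t] contains [A] exactly when the original set contains [A - t]. *)
transitivity (correlation descent_process [fset x - t | x in A]%fset).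
  congr (descent_process _); apply/seteqP; split=> S /= SA x.
    by move=> /imfsetP[y /= /SA[z Sz <-] ->]; rewrite addrK.
  move=> xA; exists (x - t); rewrite ?subrK //; apply: SA.
  by apply/imfsetP; exists x.
rewrite !descent_process_correlation /rho -(kminor_shift R (- t) (enum_fset A)).
congr _%:E; apply: kminor_perm; apply: uniq_perm.
- exact: fset_uniq.
- by rewrite map_inj_uniq ?fset_uniq //; apply: addIr.
move=> x; apply/imfsetP/mapP => -[y yA ->]; exists y => //.
Qed.

(** The event is a cylinder deciding the whole window, so its sieve is the probability of an exact
    descent set. *)
Lemma descent_process_window n a (A : {fset nat}) :
    (forall i, i \in A -> (0 < i < n)%N) ->
  descent_process (window_event n a A) =
  (desc_prob R n (enum_fset A) (compl_in n (enum_fset A)))%:E.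
Proof.
move=> An; pose B : {fset int} := [fset (a + i%:Z)%R | i in A]%fset.
pose c : seq int := [seq a + i%:Z | i <- compl_in n (enum_fset A)].
have cP (x : int) : x \in c -> exists2 i, i \in compl_in n (enum_fset A) & x = a + i%:Z.
  by move/mapP.
transitivity (descent_process (cylinder B c)).
  congr (descent_process _); apply/seteqP; split=> S /=.
    move=> SA; split=> x.
      by move=> /imfsetP[i /= iA ->]; apply/SA => //; apply: An.
    move=> xc; have [i + ->] := cP x xc; rewrite mem_filter mem_iota => /andP[iA im] Si.
    by move/negP: iA; apply; apply/SA => //; lia.
  move=> [SB Sc] i im; split=> [Si|iA].
    apply: contrapT => /negP iA; apply: (Sc (a + i%:Z)) => //.
    by apply/mapP; exists i => //; rewrite mem_filter iA mem_iota; lia.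
  by apply: SB; apply/imfsetP; exists i.
rewrite (measure_cylinder _ _ (rho := rho)); last first.
  by move=> D; rewrite -correlationE descent_process_correlation.
congr _%:E; rewrite (@sieve_window a n).
- apply: desc_prob_eq => i.
    apply/mapP/idP => [[x /imfsetP[j /= jA ->] ->]|iA].
      by rewrite (_ : `|_|%N = j) //; lia.
    by exists (a + i%:Z); [apply/imfsetP; exists i|lia].
  rewrite -map_comp (eq_map (g := id)) ?map_id // => j /=; lia.
- by move=> x /imfsetP[i /= /An im ->]; lia.
by move=> x xc; have [i + ->] := cP x xc; rewrite mem_filter mem_iota => /andP[_ im]; lia.
Qed.

Lemma descent_process_one_dependent : one_dependent descent_process.
Proof.
move=> X Y XY; rewrite !descent_process_correlation -EFinM; congr _%:E.
have dXY x : x \in X -> x \in Y -> False.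
  by move=> xX xY; have := XY _ _ xX xY; rewrite subrr.
have uXY : uniq (enum_fset X ++ enum_fset Y).
  rewrite cat_uniq !fset_uniq andbT /=; apply/hasPn => x xY; apply/negP => xX.
  exact: dXY xX xY.
rewrite /rho -kminor_cat //; apply: kminor_perm; apply: uniq_perm => [|//|x].
  exact: fset_uniq.
by rewrite mem_cat; apply: in_fsetU.
Qed.

Lemma descent_process_determinantal :
  determinantal descent_process (fun x y => desc_kernel R (y - x)).
Proof.
move=> A; rewrite descent_process_correlation; congr (\det _)%:E.
by apply/matrixP => i j; rewrite !mxE !(tnth_nth 0).
Qed.

End DescentProcess.

(** * The Laurent expansion of the kernel *)

Lemma inv_fact_le (R : realType) n : (n.+1`!%:R^-1 : R) <= 2^-1 ^+ n.
Proof.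
elim: n => [|n IHn]; first by rewrite invr1.
rewrite factS natrM invfM exprS ler_pM ?invr_ge0 //.
by rewrite lef_pV2 ?posrE ?ltr0n // ler_nat.
Qed.

(** A crude bound giving a positive radius of convergence: by induction and [inv_fact_le], the
    recursion is dominated by [2 ^ -(n + 1) + (1 - 2 ^ -n) <= 1]. *)
Lemma kern_le1 (R : realType) n : `|kern R n| <= 1.
Proof.
elim/ltn_ind: n => n IHn.
have -> : kern R n = n.+2`!%:R^-1 - \sum_(j < n) kern R j / (n.+1 - j)`!%:R.
  by rewrite -kern_rec big_ord_recr /= subSnn divr1 addrAC subrr add0r.
have sumE m : \sum_(j < m) 2^-1 ^+ (m - j) = 1 - 2^-1 ^+ m :> R.
  elim: m => [|m IHm]; first by rewrite big_ord0 subrr.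
  rewrite big_ord_recr /= subSnn expr1 (eq_bigr (fun j : 'I_m => 2^-1 * 2^-1 ^+ (m - j))).
    by rewrite -mulr_sumr IHm exprS; lra.
  by move=> j _; rewrite subSn ?exprS // ltnW.
apply: (le_trans (ler_normB _ _)).
apply: (@le_trans _ _ (2^-1 ^+ n.+1 + \sum_(j < n) 2^-1 ^+ (n - j))).
  apply: lerD; first by rewrite ger0_norm ?invr_ge0 // inv_fact_le.
  apply: (le_trans (ler_norm_sum _ _ _)); apply: ler_sum => j _.
  rewrite normrM [X in _ * X]ger0_norm ?invr_ge0 // -[leRHS]mul1r.
  by rewrite ler_pM ?IHn ?invr_ge0 // subSn ?inv_fact_le // ltnW.
rewrite sumE exprS; have : 0 <= 2^-1 ^+ n :> R by rewrite exprn_ge0 // invr_ge0.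
lra.
Qed.

Section ComplexSeries.
Variable R : realType.
Local Notation C := (Cplx R).

Definition toC (x : R) : C := real_complex R x.

HB.instance Definition _ := GRing.RMorphism.copy toC (real_complex R).

Lemma cplx_normE (z : C) :
  `|z| = toC (Num.sqrt (complex.Re z ^+ 2 + complex.Im z ^+ 2)).
Proof. exact: normc_def. Qed.

Lemma le_toC (x y : R) : (toC x <= toC y) = (x <= y).
Proof. exact: lecR. Qed.

Lemma lt_toC (x y : R) : (toC x < toC y) = (x < y).
Proof. exact: ltcR. Qed.

Lemma norm_toC (x : R) : `|toC x| = toC `|x|.
Proof. by rewrite cplx_normE /= expr0n /= addr0 sqrtr_sqr. Qed.

Lemma norm_Re_le (z : C) : toC `|complex.Re z| <= `|z|.
Proof. by rewrite cplx_normE le_toC -sqrtr_sqr ler_wsqrtr // lerDl sqr_ge0. Qed.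

Lemma norm_Im_le (z : C) : toC `|complex.Im z| <= `|z|.
Proof. by rewrite cplx_normE le_toC -sqrtr_sqr ler_wsqrtr // lerDr sqr_ge0. Qed.

Lemma cplx_norm_le (z : C) : `|z| <= toC (`|complex.Re z| + `|complex.Im z|).
Proof.
rewrite cplx_normE le_toC -[leRHS]ger0_norm ?addr_ge0 // -[leRHS]sqrtr_sqr ler_wsqrtr //.
rewrite sqrrD !real_normK ?num_real // addrAC lerDl.
by rewrite mulrn_wge0 // mulr_ge0.
Qed.

(** Real and imaginary parts are dominated by a geometric series, so they converge absolutely in
    [R]. *)
Lemma cvg_series_geometric (w : nat -> C) (r : R) : 0 <= r < 1 ->
  (forall n, `|w n| <= toC (r ^+ n)) -> exists l : C, series w @ \oo --> l.
Proof.
move=> r01 wr; have r1 : `|r| < 1 by rewrite ger0_norm; lra.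
have cvgR (f : nat -> R) : (forall n, `|f n| <= r ^+ n) -> cvgn (series f).
  move=> fr; apply: normed_cvg.
  apply: (@series_le_cvg _ _ (geometric 1 r)) => [n|n|n|].
  - by rewrite /=.
  - by rewrite /geometric /= mul1r exprn_ge0 //; lra.
  - by rewrite /geometric /= mul1r.
  exact: is_cvg_geometric_series.
have /cvg_ex[/= u ua] := cvgR (fun n => complex.Re (w n))
  (fun n => ltac:(rewrite -le_toC; exact: le_trans (norm_Re_le _) (wr n))).
have /cvg_ex[/= v vb] := cvgR (fun n => complex.Im (w n))
  (fun n => ltac:(rewrite -le_toC; exact: le_trans (norm_Im_le _) (wr n))).
have ReS n : complex.Re (series w n) = series (fun n => complex.Re (w n)) n.
  elim: n => [|n IHn]; first by rewrite /series /= !big_geq.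
  rewrite /series /= in IHn *; rewrite !big_nat_recr //= -IHn.
  by case: (\sum_(_ <= _ < _) _) (w n) => ? ? [].
have ImS n : complex.Im (series w n) = series (fun n => complex.Im (w n)) n.
  elim: n => [|n IHn]; first by rewrite /series /= !big_geq.
  rewrite /series /= in IHn *; rewrite !big_nat_recr //= -IHn.
  by case: (\sum_(_ <= _ < _) _) (w n) => ? ? [].
exists (Complex u v : C).
apply/(@cvgrPdist_lt C C nat \oo _ (series w) (Complex u v : C)) => e e0.
(* In the order on complex numbers a positive [e] is real. *)
have eE : e = toC (complex.Re e) by rewrite -[RHS]/(real_complex R _) RRe_real // gtr0_real.
rewrite eE in e0 *; rewrite (@lt_toC 0) in e0.
have e20 : 0 < complex.Re e / 2 by rewrite divr_gt0.
near=> n.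
have hu : `|u - series (fun n => complex.Re (w n)) n| < complex.Re e / 2.
  by near: n; move/cvgrPdist_lt: ua; apply.
have hv : `|v - series (fun n => complex.Im (w n)) n| < complex.Re e / 2.
  by near: n; move/cvgrPdist_lt: vb; apply.
apply: (le_lt_trans (cplx_norm_le _)); rewrite lt_toC.
rewrite -ReS in hu; rewrite -ImS in hv.
move: hu hv; case: (series w n) => x y /=; lra.
Unshelve. all: by end_near.
Qed.

(* In [A_N B_N], with [A_N], [B_N] the truncations at order [N], the terms of
   total degree less than [N] add up to [1]; each of the others, fewer than
   [N ^ 2 <= 4 ^ N], is bounded by [|z| ^ N]. *)
Lemma cauchy_product_inverse (a b : nat -> R) (z : C) :
    (forall n, `|a n| <= 1) -> (forall n, `|b n| <= 1) ->
    (forall n, \sum_(i < n.+1) a i * b (n - i)%N = (n == 0%N)%:R) ->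
    `|z| <= toC 8^-1 ->
  exists A B : C, [/\ series (fun n => toC (a n) * z ^+ n) @ \oo --> A,
    series (fun n => toC (b n) * z ^+ n) @ \oo --> B & A * B = 1].
Proof.
move=> a1 b1 ab z8.
have bound (c : nat -> R) n : (forall n, `|c n| <= 1) ->
    `|toC (c n) * z ^+ n| <= toC (8^-1 ^+ n).
  move=> c1; rewrite normrM norm_toC normrX rmorphXn -[leRHS]mul1r.
  rewrite ler_pM ?exprn_ge0 // ?(le_toC _ 1) //; first by rewrite (le_toC 0).
  by rewrite lerXn2r // nnegrE (le_toC 0) invr_ge0.
have lt8 : 0 <= (8^-1 : R) < 1 by clear; lra.
have [A cA] := @cvg_series_geometric _ _ lt8 (fun n => bound a n a1).
have [B cB] := @cvg_series_geometric _ _ lt8 (fun n => bound b n b1).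
exists A, B; split; [exact: cA|exact: cB|].
pose F i j := toC (a i) * z ^+ i * (toC (b j) * z ^+ j).
(* Passing from [N] to [N.+1] adds the antidiagonal [i + j = N.+1], whose coefficient is zero by
   [ab]. *)
have tri N : \sum_(i < N.+1) \sum_(j < N.+1 - i) F i j = 1.
  elim: N => [|N IHN].
    rewrite !big_ord1 /F !expr0 !mulr1 -rmorphM /=.
    by have := ab 0%N; rewrite big_ord1 => ->.
  rewrite big_ord_recr /= subSnn big_ord1.
  rewrite (eq_bigr (fun i : 'I_N.+1 => \sum_(j < N.+1 - i) F i j + F i (N.+1 - i)%N)); last first.
    by move=> i _; rewrite subSn ?big_ord_recr // ltnW.
  rewrite big_split /= IHN -addrA -[RHS]addr0; congr (_ + _).
  transitivity (\sum_(i < N.+2) F i (N.+1 - i)%N).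
    by rewrite [RHS]big_ord_recr /= subnn.
  rewrite (eq_bigr (fun i : 'I_N.+2 => toC (a i * b (N.+1 - i)%N) * z ^+ N.+1)).
    by rewrite -mulr_suml -rmorph_sum ab mul0r.
  move=> i _; rewrite /F mulrACA -rmorphM -exprD subnKC //.
  by rewrite -ltnS.
have prodE N : series (fun n => toC (a n) * z ^+ n) N.+1 *
    series (fun n => toC (b n) * z ^+ n) N.+1 - 1 =
    \sum_(i < N.+1) \sum_(j < N.+1 | ~~ (j < N.+1 - i)%N) F i j.
  rewrite -[X in _ - X](tri N) /series /= !big_mkord big_distrl /=.
  rewrite -sumrB; apply: eq_bigr => i _; rewrite big_distrr /=.
  rewrite (bigID (fun j : 'I_N.+1 => (j < N.+1 - i)%N)) /=.
  by rewrite -(big_ord_widen N.+1 (fun j => F i j)) ?leq_subr // addrAC subrr add0r.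
have Fle N (i j : nat) : (N <= i + j)%N -> `|F i j| <= toC (8^-1 ^+ N).
  move=> Nij; rewrite /F normrM.
  apply: (le_trans (ler_pM _ _ (bound a i a1) (bound b j b1))) => //.
  rewrite -rmorphM -exprD le_toC.
  by apply: ler_wiXn2l => //; rewrite ?invr_ge0 // invf_le1 // ler1n.
have dist N : `|1 - series (fun n => toC (a n) * z ^+ n) N.+1 *
    series (fun n => toC (b n) * z ^+ n) N.+1| <= toC (2^-1 ^+ N.+1).
  rewrite distrC prodE; apply: (le_trans (ler_norm_sum _ _ _)).
  apply: (@le_trans _ _ (\sum_(i < N.+1) \sum_(j < N.+1) toC (8^-1 ^+ N.+1))).
    apply: ler_sum => i _; apply: (le_trans (ler_norm_sum _ _ _)).
    rewrite big_mkcond /=; apply: ler_sum => j _.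
    by case: ifP => [ji|_]; [apply: Fle; lia|rewrite (le_toC 0) exprn_ge0 ?invr_ge0].
  rewrite !sumr_const card_ord -!rmorphMn le_toC -mulrnA -[leLHS]mulr_natr natrM.
  (* At most [4 ^ N.+1] terms bounded by [8 ^ -N.+1] give [2 ^ -N.+1], whence the radius [1/8]. *)
  have N2 : N.+1%:R <= 2 ^+ N.+1 :> R by rewrite -natrX ler_nat ltnW // ltn_expl.
  apply: (@le_trans _ _ (8^-1 ^+ N.+1 * (2 ^+ N.+1 * 2 ^+ N.+1))).
    by rewrite ler_pM ?exprn_ge0 ?invr_ge0 ?mulr_ge0 // ler_pM.
  rewrite -!exprMn (_ : 8^-1 * (2 * 2) = 2^-1 :> R) //.
  by clear; field.
have cAB : (fun n => series (fun n => toC (a n) * z ^+ n) n *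
    series (fun n => toC (b n) * z ^+ n) n) @ \oo --> A * B.
  exact: (@cvgM C nat \oo _ _ _ A B cA cB).
have c1 : (fun n => series (fun n => toC (a n) * z ^+ n) n *
    series (fun n => toC (b n) * z ^+ n) n) @ \oo --> (1 : C).
  apply/(@cvgrPdist_lt C C nat \oo _ _ (1 : C)) => e e0.
  have eE : e = toC (complex.Re e) by rewrite -[RHS]/(real_complex R _) RRe_real // gtr0_real.
  rewrite eE in e0 *; rewrite (@lt_toC 0) in e0.
  have half : `|2^-1 : R| < 1 by rewrite ger0_norm ?invr_ge0 // invf_lt1 ?ltr1n.
  have := cvg_geometric (1 : R) half => /cvgrPdist_lt /(_ _ e0) small.
  near=> n.
  have n0 : (0 < n)%N by near: n; exact: nbhs_infty_gt.
  have : `|0 - geometric 1 2^-1 n| < complex.Re e by near: n; exact: small.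
  rewrite sub0r normrN /geometric /= mul1r ger0_norm ?exprn_ge0 ?invr_ge0 // => sn.
  rewrite -(prednK n0); apply: (le_lt_trans (dist n.-1)).
  by rewrite lt_toC prednK.
exact: (cvg_unique _ cAB c1).
Unshelve. all: by end_near.
Qed.

(** Let [A = 1 - z * (kern 0 + kern 1 z + ...)] and [B = (e^z - 1) / z]. The recursion says
    [A * B = 1], so [1 / (1 - e^z) = - A / z], which is [(1 - A) / z] plus the polar part
    [- 1 / z]. *)
Lemma laurent_desc_kernel :
  laurent_expansion_at0 (fun z : Cplx R => (1 - cexp z)^-1) (desc_kernel R).
Proof.
rewrite /laurent_expansion_at0.
near=> z.
have z0 : z != 0 by near: z; exact: nbhs_dnbhs_neq.
have z8 : `|z| <= toC 8^-1.
  by near: z; apply: dnbhs0_le; rewrite (lt_toC 0) invr_gt0.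
pose a n := if n is m.+1 then - kern R m else 1.
pose b n : R := n.+1`!%:R^-1.
have a1 n : `|a n| <= 1 by case: n => [|n]; rewrite /a ?normrN ?kern_le1 ?normr1.
have b1 n : `|b n| <= 1.
  rewrite ger0_norm ?invr_ge0 //; apply: (le_trans (inv_fact_le _ _)).
  by rewrite exprn_ile1 ?invr_ge0 // invf_le1 // ler1n.
have ab n : \sum_(i < n.+1) a i * b (n - i)%N = (n == 0%N)%:R.
  rewrite big_ord_recl subn0 mul1r; case: n => [|l].
    by rewrite big_ord0 addr0 /b invr1.
  rewrite /b -kern_rec [X in _ + X](eq_bigr (fun j : 'I_l.+1 => - (kern R j / (l.+1 - j)`!%:R))).
    by rewrite sumrN subrr.
  by move=> j _; rewrite /= /bump /= add1n subSS mulNr subSn // -ltnS.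
have [A [B [cA cB AB]]] := cauchy_product_inverse a1 b1 ab z8.
have expE : cexp z = 1 + z * B.
  apply: (cvg_lim (@norm_hausdorff C C)).
  rewrite -(@cvg_shiftS C).
  rewrite (_ : [sequence _]_n = fun n => 1 + z * series (fun n => toC (b n) * z ^+ n) n).
    have czB : (fun n => z * series (fun n => toC (b n) * z ^+ n) n) @ \oo --> z * B.
      exact: (@cvgM C nat \oo _ (fun=> z) _ z B (cvg_cst z) cB).
    exact: (@cvgD C C nat \oo _ (fun=> 1) _ 1 (z * B) (cvg_cst (1 : C)) czB).
  apply/funext => n; rewrite /series /= !big_mkord big_ord_recl /=.
  rewrite expr0 invr1 mulr1; congr (_ + _); rewrite big_distrr /=; apply: eq_bigr => i _.
  by rewrite /bump /= add1n exprS fmorphV rmorph_nat -mulrA; congr (_ * _); rewrite mulrC.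
exists (z^-1 * (1 - A)), (- z^-1); split.
(* Because of the constant term of [A], [n] terms of the kernel series match [n.+1] terms of the
   series of [A]. *)
- rewrite (_ : series _ = fun n => z^-1 * (1 - series (fun n => toC (a n) * z ^+ n) n.+1)).
    have cAS : (fun n => series (fun n => toC (a n) * z ^+ n) n.+1) @ \oo --> A.
      rewrite (@cvg_shiftS C); exact: cA.
    have cA1 : (fun n => 1 - series (fun n => toC (a n) * z ^+ n) n.+1) @ \oo --> 1 - A.
      exact: (@cvgB C C nat \oo _ (fun=> 1) _ 1 A (cvg_cst (1 : C)) cAS).
    exact: (@cvgM C nat \oo _ (fun=> z^-1) _ z^-1 (1 - A) (cvg_cst z^-1) cA1).
  apply/funext => n; rewrite /series /= !big_mkord big_ord_recl /= expr0 mulr1.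
  rewrite [toC 1]rmorph1 opprD addNKr -sumrN big_distrr /=; apply: eq_bigr => i _.
  by rewrite /bump /= add1n exprS rmorphN mulNr opprK mulrCA mulKf.
(* Only the term of index [Negz 0] is nonzero, so the partial sums are constant once it is
   included. *)
- rewrite -(@cvg_shiftS C) (_ : [sequence _]_n = fun=> - z^-1); first exact: cvg_cst.
  apply/funext => n; rewrite /series /= big_mkord big_ord_recl big1 ?addr0.
    by rewrite rmorphN1 mulN1r.
  by move=> i _; rewrite rmorph0 mul0r.
have A0 : A != 0 by apply: contra_eq_neq AB => ->; rewrite mul0r eq_sym oner_eq0.
have BE : B = A^-1 by rewrite -[B]mul1r -(mulVf A0) -mulrA AB mulr1.
rewrite expE BE opprD addNKr -mulNr invfM invrK invrN; ring.
Unshelve. all: by end_near.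
Qed.

End ComplexSeries.

Theorem theorem5p1 (R : realType) :
  (forall (n : nat) (S : {fset nat}), (2 <= n)%N ->
     (forall s, s \in S -> (0 < s < n)%N) ->
     descent_law R n S = descent_det R n S)
  /\
  exists P : point_process int R,
    [/\ stationary P,
        (forall (n : nat) (a : int) (A : {fset nat}), (2 <= n)%N ->
           (forall i, i \in A -> (0 < i < n)%N) ->
           P (window_event n a A) = (descent_law R n A)%:E),
        one_dependent P
      & exists k : int -> R,
          laurent_expansion_at0 (fun z : Cplx R => (1 - cexp z)^-1) k /\
          determinantal P (fun x y => k (y - x))].
Proof.
split=> [n S n2 Sn|]; first by have [] := descent_law_det R n2 Sn.
exists (descent_process R); split.
- exact: descent_process_stationary.
- move=> n a A n2 An; rewrite descent_process_window //.
  by have [-> _] := descent_law_det R n2 An.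
- exact: descent_process_one_dependent.
exists (desc_kernel R); split; first exact: laurent_desc_kernel.
exact: descent_process_determinantal.
Qed.
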